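(* Let $p$ be a prime. For all $x\in\mathbb{C}_p$, $$\operatorname{Log}\Gamma_p(x+1)-\operatorname{Log}\Gamma_p(x)=\chi(x)\log_p(x).$$
   Context: $\mathbb{C}_p$ is the completion of the algebraic closure of $\mathbb{Q}_p$, with absolute value $|\cdot|_p$. $\log_p:\mathbb{C}_p^*\to\mathbb{C}_p$ is the Iwasawa $p$-adic logarithm: the homomorphism given by the usual power series of the logarithm on $\{|x-1|_p<1\}$ and normalized by $\log_p(p)=0$. The Volkenborn integral of $g:\mathbb{Z}_p\to\mathbb{C}_p$ is $\int_{\mathbb{Z}_p}g(t)\,dt:=\lim_{N\to\infty}p^{-N}\sum_{j=0}^{p^N-1}g(j)$ when the limit exists. $\chi:\mathbb{C}_p\to\{0,1\}$ is the characteristic function of $\{x\in\mathbb{C}_p:|x|_p\ge1\}$; any expression with a factor $\chi(y)$, where $|y|_p<1$, is understood to be $0$ (including $y=0$). The function $\operatorname{Log}\Gamma_p:\mathbb{C}_p\to\mathbb{C}_p$ is defined by $$\operatorname{Log}\Gamma_p(x):=\int_{\mathbb{Z}_p}(x+t)\big(\log_p(x+t)-1\big)\chi(x+t)\,dt.$$ *)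

(* Defs.v *)
From HB Require Import structures.
From mathcomp Require Import all_boot all_order all_algebra.
From mathcomp Require Import all_classical all_reals all_analysis.

Set Implicit Arguments.
Unset Strict Implicit.
Unset Printing Implicit Defensive.

Import Order.TTheory GRing.Theory Num.Theory.

Local Open Scope classical_set_scope.
Local Open Scope ring_scope.

(* A p-adic absolute value is not a norm in the sense of normedZmodType, whose
   axiom normrMn forces `|x *+ n| = `|x| *+ n; hence this separate structure. *)
Record ultrametricField (R : realType) := UltrametricField {
  uf_field : fieldType;
  uf_abs : uf_field -> R;
  uf_abs_ge0 : forall x, 0 <= uf_abs x;
  uf_abs_eq0 : forall x, uf_abs x = 0 <-> x = 0;
  uf_absM : forall x y, uf_abs (x * y) = uf_abs x * uf_abs y;
  uf_absD : forall x y, uf_abs (x + y) <= Num.max (uf_abs x) (uf_abs y)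
}.

(* The carrier is an alias of uf_field, so that it can receive the topology of
   the absolute value in addition to the field structure. *)
Definition uf_sort (R : realType) (K : ultrametricField R) : Type := uf_field K.
Coercion uf_sort : ultrametricField >-> Sortclass.

HB.instance Definition _ (R : realType) (K : ultrametricField R) :=
  GRing.Field.copy (uf_sort K) (uf_field K).
HB.instance Definition _ (R : realType) (K : ultrametricField R) :=
  isPointed.Build (uf_sort K) 0.

Definition absv (R : realType) (K : ultrametricField R) (x : K) : R := uf_abs x.

Definition uf_dist (R : realType) (K : ultrametricField R) (x y : K) : R :=
  absv (x - y).

Lemma absv1 (R : realType) (K : ultrametricField R) : absv (1 : K) = 1.
Proof.
have a1 : absv (1 : K) != 0.
  by apply/eqP => /uf_abs_eq0/eqP; apply/negP; exact: oner_neq0.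
by apply: (mulfI a1); rewrite mulr1 -[LHS]uf_absM mulr1.
Qed.

Lemma absvN (R : realType) (K : ultrametricField R) (x : K) :
  absv (- x) = absv x.
Proof.
have aN1 : absv (-1 : K) = 1.
  apply/eqP; rewrite -(@eqrXn2 _ 2) ?ler01 ?uf_abs_ge0//.
  by rewrite expr2 -[_ * _]uf_absM mulrNN mulr1 expr1n; apply/eqP/absv1.
by rewrite -mulN1r [LHS]uf_absM -/(absv _) aN1 mul1r.
Qed.

Lemma uf_distxx (R : realType) (K : ultrametricField R) (x : K) :
  uf_dist x x = 0.
Proof. by rewrite /uf_dist subrr; exact/uf_abs_eq0. Qed.

Lemma uf_dist_positivity (R : realType) (K : ultrametricField R) (x y : K) :
  uf_dist x y = 0 -> x = y.
Proof. by move=> /uf_abs_eq0 /eqP; rewrite subr_eq0 => /eqP. Qed.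

Lemma uf_dist_sym (R : realType) (K : ultrametricField R) (x y : K) :
  uf_dist x y = uf_dist y x.
Proof. by rewrite /uf_dist -absvN opprB. Qed.

Lemma uf_dist_triangle (R : realType) (K : ultrametricField R) (y x z : K) :
  uf_dist x z <= uf_dist x y + uf_dist y z.
Proof.
rewrite /uf_dist -(subrKA y x).
apply: le_trans (uf_absD _ _) _.
by rewrite ge_max lerDl lerDr !uf_abs_ge0.
Qed.

HB.instance Definition _ (R : realType) (K : ultrametricField R) :=
  isMetric.Build R (uf_sort K) (@uf_distxx R K) (@uf_dist_positivity R K)
    (@uf_dist_sym R K) (@uf_dist_triangle R K).

(* Q_p as the closure of the rationals: when K is complete and its absolute
   value extends the p-adic one, this closure is the completion of rat for the
   p-adic absolute value. *)
Definition padic_subfield (R : realType) (K : ultrametricField R) : set K :=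
  closure (range (@ratr K)).

Definition padic_algebraic (R : realType) (K : ultrametricField R) : set K :=
  [set x | exists q : {poly K},
     [/\ q != 0, (forall i, padic_subfield q`_i) & root q x]].

(* K is (a model of) C_p, the completion of the algebraic closure of Q_p: it is
   complete for an absolute value normalized by |p| = 1/p, and the elements
   algebraic over Q_p form a dense, algebraically closed subfield.  This
   determines K up to isometric isomorphism, in the same way as realType
   determines the real numbers. *)
Record is_complex_padic (R : realType) (p : nat) (K : ultrametricField R)
    : Prop := IsComplexPadic {
  padic_abs_prime : absv (p%:R : K) = p%:R^-1;
  padic_complete : forall F : set_system K, ProperFilter F -> cauchy F -> cvg F;
  padic_algebraic_closed : forall q : {poly K},
    (forall i, padic_algebraic q`_i) -> (1 < size q)%N ->
    exists2 x : K, padic_algebraic x & root q x;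
  padic_algebraic_dense : closure (@padic_algebraic R K) = setT
}.

(* The defining properties of the Iwasawa logarithm; the value at 0 is left
   unconstrained, since the logarithm is only defined on nonzero elements. *)
Definition is_iwasawa_log (R : realType) (p : nat) (K : ultrametricField R)
    (L : K -> K) : Prop :=
  [/\ forall x y : K, x != 0 -> y != 0 -> L (x * y) = L x + L y,
      forall x : K, absv (x - 1) < 1 ->
        series (fun n => (-1) ^+ n * (x - 1) ^+ n.+1 / n.+1%:R) @ \oo --> L x
    & L p%:R = 0].

(* On C_p, the properties above determine the values at nonzero elements. *)
Definition logp (R : realType) (p : nat) (K : ultrametricField R) : K -> K :=
  get [set L : K -> K | is_iwasawa_log p L].

(* The integrand is given on all of K, but only its values at natural numbers,
   which are elements of Z_p, occur. *)
Definition volkenborn (R : realType) (p : nat) (K : ultrametricField R)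
    (g : K -> K) : K :=
  lim ((fun N : nat => (p%:R ^+ N)^-1 * \sum_(0 <= j < p ^ N) g j%:R) @ \oo).

Definition chi (R : realType) (K : ultrametricField R) (x : K) : K :=
  if 1 <= absv x then 1 else 0.

Definition LogGammap (R : realType) (p : nat) (K : ultrametricField R) (x : K)
    : K :=
  volkenborn p (fun t : K => (x + t) * (logp p (x + t) - 1) * chi (x + t)).

(* Main.v *)
(** By the ultrametric inequality, the Volkenborn sums of [f y = y (log y - 1) chi y]
    along [x + Z_p] converge: [f (y + h) - f y - h g y] is [O(h^2)] with
    [g y = chi y log y], and the sums of [g] over [p^N] consecutive points are
    [O(p^-N)].  Shifting [x] by 1 makes the sums telescope to
    [(f (x + p^N) - f x) / p^N], which tends to [g x].

    As [logp] is a choice among the Iwasawa logarithms, one must exist.  On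
    [|x - 1| < 1] the logarithmic series is the limit of [(x^(p^N) - 1) / p^N],
    which makes its additivity elementary; it then extends to the multiplicative
    group of [K], killing [p], because the additive group of [K] is divisible. *)

Require Import Defs.
From mathcomp Require Import all_boot all_order all_algebra.
From mathcomp Require Import all_classical all_reals all_analysis ring lra.

Import Order.TTheory GRing.Theory Num.Theory.

Local Open Scope ring_scope.

(** * Ultrametric inequalities and limits *)

Section AbsoluteValue.
Context {R : realType} {K : ultrametricField R}.
Implicit Types x y z : K.

Lemma absv_ge0 x : 0 <= absv x. Proof. exact: uf_abs_ge0. Qed.

Lemma absv_eq0 x : (absv x == 0) = (x == 0).
Proof. by apply/eqP/eqP => /uf_abs_eq0. Qed.

Lemma absv_gt0 x : (0 < absv x) = (x != 0).
Proof. by rewrite lt0r absv_eq0 absv_ge0 andbT. Qed.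

Lemma absv0 : absv (0 : K) = 0. Proof. by apply/eqP; rewrite absv_eq0. Qed.

Lemma absvM x y : absv (x * y) = absv x * absv y. Proof. exact: uf_absM. Qed.

Lemma absvX x n : absv (x ^+ n) = absv x ^+ n.
Proof. by elim: n => [|n IHn]; rewrite ?absv1// !exprS absvM IHn. Qed.

Lemma absvV x : absv x^-1 = (absv x)^-1.
Proof.
have [->|x0] := eqVneq x 0; first by rewrite invr0 absv0 invr0.
apply: (@mulfI _ (absv x)); first by rewrite absv_eq0.
by rewrite -absvM !divff ?absv_eq0// absv1.
Qed.

Lemma absvD_le x y B : absv x <= B -> absv y <= B -> absv (x + y) <= B.
Proof.
by move=> xB yB; apply: le_trans (uf_absD _ _) _; rewrite ge_max xB.
Qed.

Lemma absvB_le x y B : absv x <= B -> absv y <= B -> absv (x - y) <= B.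
Proof. by move=> xB yB; rewrite absvD_le ?absvN. Qed.

Lemma absvD_lt x y B : absv x < B -> absv y < B -> absv (x + y) < B.
Proof.
by move=> xB yB; apply: le_lt_trans (uf_absD _ _) _; rewrite gt_max xB.
Qed.

Lemma absvBC x y : absv (x - y) = absv (y - x).
Proof. by rewrite -absvN opprB. Qed.

Lemma absv_sum (I : Type) (r : seq I) (P : pred I) (F : I -> K) (B : R) :
  0 <= B -> (forall i, P i -> absv (F i) <= B) ->
  absv (\sum_(i <- r | P i) F i) <= B.
Proof.
move=> B0 FB; elim/big_rec: _ => [|i x Pi]; first by rewrite absv0.
exact/absvD_le/FB.
Qed.

(** Otherwise [x = (x + y) - y] would be a difference of two elements smaller than [x]. *)
Lemma absv_addr_lt x y : absv y < absv x -> absv (x + y) = absv x.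
Proof.
move=> yx; apply: le_anti; rewrite absvD_le ?(ltW yx)//=.
rewrite leNgt; apply/negP => xyx.
suff : absv x < absv x by rewrite ltxx.
by rewrite -{1}(addrK y x) absvD_lt ?absvN.
Qed.

Lemma absv_eq1 x : absv (x - 1) < 1 -> absv x = 1.
Proof.
by move=> x1; rewrite -(subrK 1 x) addrC absv_addr_lt absv1.
Qed.

Lemma absv_nat_le1 n : absv (n%:R : K) <= 1.
Proof.
elim: n => [|n IHn]; first by rewrite absv0.
by rewrite -natr1 absvD_le// absv1.
Qed.

Lemma cvg_absvP (u : nat -> K) (l : K) :
  (u @ \oo --> l)%classic <->
  forall e : R, 0 < e -> exists N, forall n, (N <= n)%N -> absv (u n - l) < e.
Proof.
split=> [/cvg_ballP ul e e0|ul].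
  have [N _ uN] := ul _ e0; exists N => n /uN.
  by rewrite /= ballEmdist /= absvBC.
apply/cvg_ballP => e /ul[N uN]; exists N => // n /uN.
by rewrite /= ballEmdist /= absvBC.
Qed.

(** If the bound failed, a late term [u n] would be closer to both [l] and [a] than these are to
    each other, against the ultrametric inequality. *)
Lemma absv_lim_le (u : nat -> K) (l a : K) (B : R) (N : nat) :
  (u @ \oo --> l)%classic -> (forall n, (N <= n)%N -> absv (u n - a) <= B) ->
  absv (l - a) <= B.
Proof.
move=> /cvg_absvP ul uB; rewrite leNgt; apply/negP => Bla.
have [M uM] := ul _ (le_lt_trans (le_trans (absv_ge0 _) (uB N (leqnn N))) Bla).
have := uM _ (leq_maxl M N); rewrite absvBC => lu.
suff : absv (l - a) < absv (l - a) by rewrite ltxx.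
rewrite -{1}(subrK (u (maxn M N)) l) -addrA absvD_lt//.
by apply: le_lt_trans Bla; rewrite uB ?leq_maxr.
Qed.

(* In a complete ultrametric space, null increments make a Cauchy sequence. *)
Lemma cvg_absv_increments (u : nat -> K) :
  (forall F : set_system K, ProperFilter F -> cauchy F -> cvg F) ->
  (forall e : R, 0 < e ->
     exists N, forall n, (N <= n)%N -> absv (u n.+1 - u n) < e) ->
  exists l : K, (u @ \oo --> l)%classic.
Proof.
move=> K_complete du; have /K_complete: cauchy (u @ \oo)%classic; last first.
  by move=> /cvg_ex[l ul]; exists l.
apply: cauchy_exP => e e0; have [N uN] := du _ e0.
exists (u N); exists N => //= n; rewrite /= ballEmdist /= => Nn.
rewrite -[mdist _ _]/(absv _) absvBC -(subnK Nn).
elim: (n - N)%N => [|k IHk]; first by rewrite add0n subrr absv0.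
rewrite addSn -(subrK (u (k + N)%N) (u (k + N).+1)) -addrA absvD_lt//.
by rewrite uN ?leq_addl.
Qed.

End AbsoluteValue.

(** * Geometric decay in the real numbers *)

Section Geometric.
Context {R : realType}.
Implicit Types q C : R.

Lemma geometric_lt q C e : 0 <= q < 1 -> 0 < e ->
  exists N, forall n, (N <= n)%N -> C * q ^+ n < e.
Proof.
move=> /andP[q0 q1] e0.
have /cvgrPdist_lt/(_ (e / (`|C| + 1))) : (q ^+ n @[n --> \oo] --> 0)%classic.
  by apply: cvg_expr; rewrite ger0_norm.
rewrite divr_gt0 ?ltr_wpDl// => /(_ isT)[N _ qN]; exists N => n /qN /=.
rewrite sub0r normrN normrX (ger0_norm q0) ltr_pdivlMr ?ltr_wpDl// => qe.
apply: le_lt_trans (ler_norm _) _; rewrite normrM [X in _ * X]ger0_norm ?exprn_ge0//.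
by apply: le_lt_trans qe; rewrite mulrC ler_wpM2l ?exprn_ge0// lerDl.
Qed.

(** Turns an estimate at every precision [N] into an exact identity; [a] will be the absolute value
    of a defect of additivity. *)
Lemma geometric_le0 q C a : 0 <= q < 1 -> (forall N, a <= C * q ^+ N) -> a <= 0.
Proof.
move=> q01 aC; rewrite leNgt; apply/negP => a0.
have [N /(_ _ (leqnn N))] := geometric_lt q C a q01 a0.
by rewrite ltNge aC.
Qed.

(** Each of the [n] terms of [1 + q + ... + q^(n-1)] is at least [q^n], and the sum is at most
    [1 / (1 - q)]. *)
Lemma natr_geometric_le q n : 0 <= q < 1 -> n%:R * q ^+ n <= (1 - q)^-1.
Proof.
move=> /andP[q0 q1]; have q10 : 0 < 1 - q by rewrite subr_gt0.
rewrite -[leRHS]mul1r ler_pdivlMr//.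
apply: (@le_trans _ _ ((\sum_(i < n) q ^+ i) * (1 - q))).
  rewrite ler_pM2r// -[n in n%:R]card_ord -sum1_card natr_sum mulr_suml ler_sum//.
  by move=> i _; rewrite mul1r ler_wiXn2l ?(ltW q1)// ltnW.
by rewrite mulrC -opprB mulNr -subrX1 opprB gerBl exprn_ge0.
Qed.

(** The previous bound for [Num.sqrt q], squared. Two factors [n] must be absorbed later: one from
    the denominators of the logarithmic series, one from [binomial_near_sign]. *)
Lemma sqr_natr_geometric_le q n : 0 <= q < 1 ->
  n%:R ^+ 2 * q ^+ n <= (1 - Num.sqrt q)^-1 ^+ 2.
Proof.
move=> /andP[q0 q1]; rewrite -{1}(sqr_sqrtr q0) exprAC -exprMn.
rewrite lerXn2r ?nnegrE ?mulr_ge0 ?exprn_ge0 ?sqrtr_ge0//.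
  by rewrite invr_ge0 subr_ge0 -sqrtr1 ler_sqrt// ltW.
by apply: natr_geometric_le; rewrite sqrtr_ge0 -sqrtr1 ltr_sqrt.
Qed.

End Geometric.

(** * Absolute values of integers and binomial coefficients *)

Section PadicAbsoluteValue.
Context {R : realType} {K : ultrametricField R} {p : nat}.
Hypothesis p_prime : prime p.
Hypothesis absvp : absv (p%:R : K) = p%:R^-1.

Let q : R := p%:R^-1.

Lemma inv_prime_itv : 0 <= q < 1.
Proof.
rewrite invr_ge0 ler0n invf_lt1 ?ltr0n ?prime_gt0//.
by rewrite (ltr_nat _ 1%N) prime_gt1.
Qed.

Lemma absv_expp n : absv (p%:R ^+ n : K) = q ^+ n.
Proof. by rewrite absvX absvp. Qed.

Lemma absv_natX n : absv ((p ^ n)%:R : K) = q ^+ n.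
Proof. by rewrite natrX absv_expp. Qed.

(** If [|n| < 1], both terms of a Bezout relation [1 = b p - a n] would have absolute value below
    1. *)
Lemma absv_coprime n : coprime p n -> absv (n%:R : K) = 1.
Proof.
move=> pn; apply: le_anti; rewrite absv_nat_le1 leNgt/=; apply/negP => n1.
have [a _ /dvdnP[b]] := Bezoutl n (prime_gt0 p_prime).
rewrite (eqP pn) => /(congr1 (fun k => k%:R : K)); rewrite natrD !natrM.
move=> e; suff : 1 < 1 :> R by rewrite ltxx.
have one : 1 = b%:R * p%:R - a%:R * n%:R :> K by rewrite -e addrK.
rewrite -{1}(@absv1 R K) one absvD_lt ?absvN// absvM.
  rewrite (le_lt_trans (ler_wpM2r (absv_ge0 _) (absv_nat_le1 _)))// mul1r.
  by rewrite absvp; case/andP: inv_prime_itv.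
by rewrite (le_lt_trans (ler_wpM2r (absv_ge0 _) (absv_nat_le1 _)))// mul1r.
Qed.

(** With [n = m p^k] and [m] prime to [p], [|n| = p^-k] and [p^k <= n]. *)
Lemma absv_nat_ge n : (0 < n)%N -> n%:R^-1 <= absv (n%:R : K).
Proof.
move=> n0; have [m pm ->] := pfactor_coprime p_prime n0.
have m0 : (0 < m)%N.
  case: m pm => //; rewrite /coprime gcdn0 => /eqP p1.
  by move: p_prime; rewrite p1.
rewrite [X in absv X]natrM absvM absv_coprime// mul1r absv_natX exprVn -natrX.
rewrite lef_pV2 ?posrE ?ltr0n ?muln_gt0 ?m0 ?expn_gt0 ?prime_gt0//.
by rewrite ler_nat leq_pmull.
Qed.

Lemma absv_nat_gt0 n : (0 < n)%N -> 0 < absv (n%:R : K).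
Proof. by move=> n0; rewrite (lt_le_trans _ (absv_nat_ge _ n0))// invr_gt0 ltr0n. Qed.

Lemma absv_natf_neq0 n : (0 < n)%N -> (n%:R : K) != 0.
Proof. by move=> n0; rewrite -absv_gt0 absv_nat_gt0. Qed.

Lemma absv_natV_le n : (0 < n)%N -> absv (n%:R^-1 : K) <= n%:R.
Proof.
move=> n0; rewrite absvV -[leRHS]invrK lef_pV2 ?absv_nat_ge// posrE.
  exact: absv_nat_gt0.
by rewrite invr_gt0 ltr0n.
Qed.

Lemma absv_log_term (u : K) n :
  absv ((-1) ^+ n * u ^+ n.+1 / n.+1%:R) <= n.+1%:R * absv u ^+ n.+1.
Proof.
rewrite !absvM !absvX absvN absv1 expr1n mul1r mulrC.
by rewrite ler_wpM2r ?exprn_ge0 ?absv_ge0// absv_natV_le.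
Qed.

(** Induction on [k] by Pascal's rule. With [m = p^N], each step brings in [binom(m, k+1) = m /
    (k+1) * binom(m-1, k)], of absolute value at most [(k+1) q^N]. *)
Lemma binomial_near_sign N k :
  absv ('C((p ^ N).-1, k)%:R - (-1) ^+ k : K) <= k%:R * q ^+ N.
Proof.
have q0 : 0 <= q by case/andP: inv_prime_itv.
elim: k => [|k IHk]; first by rewrite bin0 expr0 subrr absv0 mul0r.
have m0 : (0 < p ^ N)%N by rewrite expn_gt0 prime_gt0.
have -> : 'C((p ^ N).-1, k.+1)%:R - (-1) ^+ k.+1 =
    'C(p ^ N, k.+1)%:R - ('C((p ^ N).-1, k)%:R - (-1) ^+ k) :> K.
  by rewrite -[in RHS](prednK m0) binS natrD exprS/=; ring.
apply: absvB_le; last first.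
  by apply: le_trans IHk _; rewrite ler_wpM2r ?exprn_ge0// ler_nat.
have /(congr1 (fun k => absv (k%:R : K))) := mul_bin_diag (p ^ N) k.
rewrite !natrM !absvM absv_natX => e.
have k0 : 0 < absv (k.+1%:R : K) by exact: absv_nat_gt0.
rewrite -(ler_pM2l k0) -e.
apply: (@le_trans _ _ (q ^+ N)); first by rewrite ler_piMr ?exprn_ge0 ?absv_nat_le1.
rewrite mulrA ler_peMl ?exprn_ge0//.
by rewrite -ler_pdivrMr ?ltr0n// mul1r absv_nat_ge.
Qed.

(** The binomial theorem with [binom(m, k+1) / m = binom(m-1, k) / (k+1)]. Padding the sum with
    vanishing binomials up to any [n >= m] allows a termwise comparison with partial sums of the
    logarithmic series. *)
Lemma powp_sub1E (u : K) m n : (0 < m <= n)%N ->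
  ((1 + u) ^+ m - 1) / m%:R =
  \sum_(0 <= k < n) 'C(m.-1, k)%:R * u ^+ k.+1 / k.+1%:R.
Proof.
move=> /andP[m0 mn]; rewrite (big_cat_nat (leq0n m) mn)/= [X in _ = _ + X]big_nat_cond.
rewrite [X in _ = _ + X]big1 ?addr0 => [|k]; last first.
  by rewrite andbT => /andP[mk _]; rewrite bin_small ?prednK// !mul0r.
rewrite exprDn big_ord_recl/= expr1n expr0 mulr1 bin0 mulr1n addrAC subrr add0r.
rewrite big_mkord mulr_suml; apply: eq_bigr => i _.
rewrite expr1n mul1r -mulr_natl.
have := mul_bin_diag m i => /(congr1 (fun k => k%:R : K)); rewrite !natrM => e.
have m0K := absv_natf_neq0 m m0; have i0K := absv_natf_neq0 i.+1 isT.
have -> : 'C(m, i.+1)%:R = m%:R * 'C(m.-1, i)%:R / i.+1%:R :> K.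
  by rewrite e mulrC mulKf.
rewrite (_ : bump 0 i = i.+1)//.
by rewrite mulrC !mulrA mulVf// mul1r mulrAC.
Qed.

End PadicAbsoluteValue.

(** * The logarithm on the open unit disc around 1 *)

Section LogarithmicSeries.
Context {R : realType} {K : ultrametricField R} {p : nat}.
Hypothesis p_prime : prime p.
Hypothesis absvp : absv (p%:R : K) = p%:R^-1.
Hypothesis K_complete :
  forall F : set_system K, ProperFilter F -> cauchy F -> cvg F.

Let q : R := p%:R^-1.

Definition log_series (x : K) : nat -> K :=
  series (fun n => (-1) ^+ n * (x - 1) ^+ n.+1 / n.+1%:R).

(** A common bound for all [n^2 |u|^n] when [|u| < 1]. *)
Definition log1p_bound (u : K) : R := (1 - Num.sqrt (absv u))^-1 ^+ 2.

Lemma log1p_bound_ge0 u : 0 <= log1p_bound u.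
Proof. exact: sqr_ge0. Qed.

Lemma sqr_natr_absv_le (u : K) n : absv u < 1 ->
  n%:R ^+ 2 * absv u ^+ n <= log1p_bound u.
Proof. by move=> u1; apply: sqr_natr_geometric_le; rewrite absv_ge0. Qed.

(** With [B = log1p_bound (x - 1)], the term of index [n] is at most [B / (n+1)], and null
    increments suffice. *)
Lemma log_series_is_cvg (x : K) : absv (x - 1) < 1 ->
  exists l : K, (log_series x @ \oo --> l)%classic.
Proof.
move=> x1; apply: cvg_absv_increments => // e e0.
have B0 : 0 <= log1p_bound (x - 1) / e by rewrite divr_ge0 ?log1p_bound_ge0// ltW.
exists (Num.bound (log1p_bound (x - 1) / e)) => n nB.
rewrite /log_series seriesSB; apply: le_lt_trans (absv_log_term p_prime absvp _ _) _.
have n0 : 0 < n.+1%:R :> R by rewrite ltr0n.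
rewrite -(ltr_pM2l n0) mulrA -expr2.
apply: le_lt_trans (sqr_natr_absv_le _ _ x1) _.
rewrite -ltr_pdivrMr//; apply: lt_le_trans (archi_boundP B0) _.
by rewrite ler_nat (leq_trans nB).
Qed.

Definition plog (x : K) : K := lim (log_series x @ \oo)%classic.

Lemma plog_cvg (x : K) : absv (x - 1) < 1 ->
  (log_series x @ \oo --> plog x)%classic.
Proof.
by move=> /log_series_is_cvg[l xl]; rewrite /plog (cvg_lim (@metric_hausdorff _ K) xl).
Qed.

(* Since [(x ^ m - 1) / m] is the sum of the [binom(m - 1, k) u ^ (k + 1) / (k + 1)]
   for [x = 1 + u], and [binom(m - 1, k)] is [(-1) ^ k] up to [k |m|] for
   [m = p ^ N]. *)
Lemma plog_powp (x : K) N : absv (x - 1) < 1 ->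
  absv (plog x - (x ^+ (p ^ N) - 1) / (p ^ N)%:R) <= log1p_bound (x - 1) * q ^+ N.
Proof.
move=> x1; have q0 : 0 <= q by rewrite invr_ge0.
apply: (absv_lim_le _ _ _ _ (p ^ N) (plog_cvg _ x1)) => n Nn.
rewrite -{2}(subrK 1 x) [x - 1 + 1]addrC (powp_sub1E p_prime absvp _ _ n); last first.
  by rewrite expn_gt0 prime_gt0.
move: (log1p_bound (x - 1)) (log1p_bound_ge0 (x - 1))
  (fun k => sqr_natr_absv_le (x - 1) k x1) => B B0 kB.
rewrite /log_series /series/= -sumrB; apply: absv_sum => [|k _].
  by rewrite mulr_ge0 ?exprn_ge0.
rewrite -!mulrA -mulrBl absvM absvBC mulrC.
have := binomial_near_sign p_prime absvp N k; rewrite -/q => kN.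
apply: (@le_trans _ _ (k.+1%:R * absv (x - 1) ^+ k.+1 * (k%:R * q ^+ N))).
  apply: ler_pM; rewrite ?absv_ge0//.
  have := absv_log_term p_prime absvp (x - 1) k.
  by rewrite -mulrA absvM absvX absvN absv1 expr1n mul1r.
rewrite mulrA ler_wpM2r ?exprn_ge0//.
apply: le_trans (kB k.+1).
by rewrite expr2 mulrAC ler_wpM2r ?exprn_ge0 ?absv_ge0// ler_wpM2l// ler_nat.
Qed.

Lemma absv_sub1M (x y : K) :
  absv (x - 1) < 1 -> absv (y - 1) < 1 -> absv (x * y - 1) < 1.
Proof.
move=> x1 y1; rewrite (_ : x * y - 1 = (x - 1) * y + (y - 1)); last by ring.
by rewrite absvD_lt// absvM [absv y]absv_eq1// mulr1.
Qed.

Lemma absv_sub1V (x : K) : absv (x - 1) < 1 -> absv (x^-1 - 1) < 1.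
Proof.
move=> x1; have x0 : x != 0 by rewrite -absv_gt0 absv_eq1.
rewrite (_ : x^-1 - 1 = - (x - 1) / x); last by field.
by rewrite absvM absvN absvV [absv x]absv_eq1// invr1 mulr1.
Qed.

(* With [P x := (x ^ m - 1) / m], [P (x * y) = P x + P y + m * P x * P y]. *)
Lemma plogM (x y : K) : absv (x - 1) < 1 -> absv (y - 1) < 1 ->
  plog (x * y) = plog x + plog y.
Proof.
move=> x1 y1; have xy1 := absv_sub1M _ _ x1 y1.
have q01 : 0 <= q < 1 by exact: inv_prime_itv.
have q0 : 0 <= q by case/andP: q01.
set Bx := log1p_bound (x - 1); set By := log1p_bound (y - 1).
set Bxy := log1p_bound (x * y - 1).
have Bx0 : 0 <= Bx := log1p_bound_ge0 _.
have By0 : 0 <= By := log1p_bound_ge0 _.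
have Bxy0 : 0 <= Bxy := log1p_bound_ge0 _.
(* [C] bounds [P x * P y] uniformly in [N]; the cross term gets its [q ^ N] from the factor
   [p ^ N]. *)
set C := (absv (plog x) + Bx) * (absv (plog y) + By).
have C0 : 0 <= C by rewrite mulr_ge0 ?addr_ge0 ?absv_ge0.
apply/eqP; rewrite -subr_eq0 -absv_eq0; apply/eqP/le_anti; rewrite absv_ge0 andbT.
apply: (@geometric_le0 _ q (Bxy + Bx + By + C)) => // N.
pose P (z : K) : K := (z ^+ (p ^ N) - 1) / (p ^ N)%:R.
have P_le (z : K) : absv (z - 1) < 1 ->
    absv (P z) <= absv (plog z) + log1p_bound (z - 1).
  move=> z1; rewrite -(subKr (plog z) (P z)) absvB_le//.
    by rewrite lerDl log1p_bound_ge0.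
  apply: le_trans (plog_powp _ N z1) _; apply: (@le_trans _ _ (log1p_bound (z - 1))).
    by rewrite ler_piMr ?log1p_bound_ge0// exprn_ile1// ltW//; case/andP: q01.
  by rewrite lerDr absv_ge0.
have m0 : ((p ^ N)%:R : K) != 0.
  by rewrite (absv_natf_neq0 p_prime absvp)// expn_gt0 prime_gt0.
have -> : plog (x * y) - (plog x + plog y) =
    (plog (x * y) - P (x * y)) - (plog x - P x) - (plog y - P y)
    + (p ^ N)%:R * P x * P y.
  by rewrite /P exprMn; field.
have qN0 : 0 <= q ^+ N by rewrite exprn_ge0.
have BqN (B B' : R) : B <= B' -> B * q ^+ N <= B' * q ^+ N by move=> ?; rewrite ler_wpM2r.
apply: absvD_le; [apply: absvB_le; [apply: absvB_le|]|].
- by apply: le_trans (plog_powp _ N xy1) _; apply: BqN; rewrite -/Bxy; lra.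
- by apply: le_trans (plog_powp _ N x1) _; apply: BqN; rewrite -/Bx; lra.
- by apply: le_trans (plog_powp _ N y1) _; apply: BqN; rewrite -/By; lra.
rewrite -mulrA absvM absvM (absv_natX absvp) -/q mulrC ler_wpM2r//.
apply: (@le_trans _ _ C); last by lra.
by apply: ler_pM; rewrite ?absv_ge0 ?P_le.
Qed.

(** The series starts with [u]; the later terms are at most [(k+2) |u|^(k+2) <= 2 |u|^2], because
    [|u| <= 1/2] and [k+2 <= 2^(k+1)]. *)
Lemma log1p_approx (u l : K) : absv u <= q ->
  (log_series (1 + u) @ \oo --> l)%classic ->
  absv (l - u) <= 2 * absv u ^+ 2.
Proof.
move=> uq ul; have u2 : absv u <= 2^-1.
  apply: le_trans uq _; rewrite lef_pV2 ?posrE ?ltr0n ?prime_gt0//.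
  by rewrite (ler_nat _ 2) prime_gt1.
apply: (absv_lim_le _ _ _ _ 1%N ul) => -[//|n] _.
rewrite /log_series /series/= big_nat_recl// addrAC.
rewrite expr0 mul1r expr1 divr1 [1 + u]addrC addrK subrr add0r.
apply: absv_sum => [|k _]; first by rewrite mulr_ge0// sqr_ge0.
apply: le_trans (absv_log_term p_prime absvp _ _) _.
rewrite -addn2 exprD mulrA ler_wpM2r ?sqr_ge0//.
apply: (@le_trans _ _ ((k + 2)%:R * 2^-1 ^+ k)).
  by rewrite ler_wpM2l// lerXn2r ?nnegrE ?absv_ge0.
rewrite exprVn ler_pdivrMr ?exprn_gt0// -exprS -natrX ler_nat addn2.
exact: ltn_expl.
Qed.

End LogarithmicSeries.

(** * Extending partial homomorphisms by Zorn's lemma *)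

Section MultiplicativeExtension.
Context {F V : fieldType}.
Hypothesis V_char0 : forall n, (0 < n)%N -> (n%:R : V) != 0.

(** A homomorphism from a multiplicative subgroup of [F] to the additive group of [V], encoded by
    its graph so that extension is inclusion. Being single-valued at 1 makes it so everywhere, by
    taking quotients. *)
Record partial_hom (G : set (F * V)) : Prop := PartialHom {
  partial_hom1 : G (1, 0);
  partial_homM : forall x y a b, G (x, a) -> G (y, b) -> G (x * y, a + b);
  partial_homV : forall x a, G (x, a) -> G (x^-1, - a);
  partial_hom_neq0 : forall x a, G (x, a) -> x != 0;
  partial_hom_fun1 : forall a, G (1, a) -> a = 0
}.

Lemma partial_hom_fun G x a b :
  partial_hom G -> G (x, a) -> G (x, b) -> a = b.
Proof.
move=> PG xa xb; apply/eqP; rewrite -subr_eq0; apply/eqP.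
apply: (partial_hom_fun1 _ PG); rewrite -(divff (partial_hom_neq0 _ PG _ _ xa)).
by apply: partial_homM => //; exact: partial_homV.
Qed.

Lemma partial_homX G x a n : partial_hom G -> G (x, a) -> G (x ^+ n, a *+ n).
Proof.
move=> PG xa; elim: n => [|n IHn]; first by rewrite expr0; exact: partial_hom1.
by rewrite exprS mulrS; exact: partial_homM.
Qed.

Lemma partial_homXz G x a (k : int) : partial_hom G -> G (x, a) -> G (x ^ k, a *~ k).
Proof.
move=> PG xa; case: k => n; first exact: partial_homX.
by rewrite NegzE -exprnN mulrNz; by apply: partial_homV => //; exact: partial_homX.
Qed.

(* The additive group of [V] is divisible. *)
Lemma partial_hom_candidate G x : partial_hom G -> x != 0 ->
  exists c, forall (k : int) b, G (x ^ k, b) -> b = c *~ k.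
Proof.
move=> PG x0; have [[n [b [n0 nb]]]|noG] :=
  pselect (exists n b, (0 < n)%N /\ G (x ^+ n, b)).
  (* A power [x ^+ n] in the domain with value [b] forces the value [b / n]; the equality is checked
     after multiplying by [n]. *)
  exists (b / n%:R) => k b' kb'.
  have kb'n := partial_homX _ _ _ n PG kb'; have nbk := partial_homXz _ _ _ k PG nb.
  have e : (x ^ k) ^+ n = (x ^+ n) ^ k by rewrite !exprnP !exprz_exp mulrC.
  rewrite e in kb'n; have := partial_hom_fun _ _ _ _ PG kb'n nbk => b'b.
  apply: (mulIf (V_char0 n n0)); rewrite mulr_natr b'b -mulrzl -[in RHS]mulrzl -mulrA.
  by rewrite divfK ?V_char0.
(* No positive power of [x] is in the domain, so [x ^ k] lies in it only for [k = 0], and any [c]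
   would do. *)
exists 0; rewrite /= => -[[|n]|n] b kb; rewrite mul0rz.
- exact: (partial_hom_fun1 _ PG).
- by case: noG; exists n.+1, b.
- case: noG; exists n.+1, (- b); split => //; have := partial_homV _ PG _ _ kb.
  by rewrite NegzE -exprnN invrK.
Qed.

(** The new domain consists of the [y * x ^ k] with [y] in the old one. A relation [y * x ^ k = 1]
    puts [x ^ (- k)] in the old domain, where the candidate value [c] agrees with [G]. *)
Lemma partial_hom_adjoin G x : partial_hom G -> x != 0 ->
  exists G', [/\ partial_hom G', (G `<=` G')%classic & exists c, G' (x, c)].
Proof.
move=> PG x0; have [c cP] := partial_hom_candidate _ _ PG x0.
exists [set z | exists y b (k : int), G (y, b) /\ z = (y * x ^ k, b + c *~ k)]%classic.
split.
- split=> [|y1 y2 a1 a2 [z1 [b1 [k1 [G1 [-> ->]]]]] [z2 [b2 [k2 [G2 [-> ->]]]]]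
    |y a [z [b [k [Gz [-> ->]]]]]|y a [z [b [k [Gz [-> _]]]]]
    |a [y [b [k [Gy [e ->]]]]]].
  + exists 1, 0, 0; split; first exact: partial_hom1.
    by rewrite expr0z mulr1 mulr0z addr0.
  + exists (z1 * z2), (b1 + b2), (k1 + k2); split; first exact: partial_homM.
    by rewrite expfzDr// mulrzDr mulrACA addrACA.
  + exists z^-1, (- b), (- k); split; first exact: partial_homV.
    by rewrite invfM invr_expz mulrNz opprD.
  + by rewrite mulf_neq0 ?expfz_neq0// (partial_hom_neq0 _ PG _ _ Gz).
  + have yE : y = x ^ (- k).
      by rewrite -invr_expz -[LHS](mulfK (expfz_neq0 k x0)) -e mul1r.
    by rewrite yE in Gy; rewrite (cP _ _ Gy) mulrNz addNr.
- by move=> [y b] Gy; exists y, b, 0; rewrite expr0z mulr1 mulr0z addr0.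
- exists c, 1, 0, 1; split; first exact: partial_hom1.
  by rewrite mul1r add0r expr1z mulr1z.
Qed.

Lemma partial_hom_extend G0 : partial_hom G0 ->
  exists L : F -> V,
    (forall x y, x != 0 -> y != 0 -> L (x * y) = L x + L y) /\
    (forall x a, G0 (x, a) -> L x = a).
Proof.
(* Joining [G0] to every set makes the property hold for the union of the empty chain too. *)
move=> P0; pose P (A : set (F * V)) := partial_hom (A `|` G0)%classic.
have [C CP totC|A [PA maxA]] := @Zorn_bigcup _ P.
  (* Two points of the union already lie in one partial homomorphism below it, which gives the
     closure properties. *)
  have common z1 z2 : (\bigcup_(X in C) X `|` G0)%classic z1 ->
      (\bigcup_(X in C) X `|` G0)%classic z2 ->
      exists2 G : set (F * V), partial_hom G &
        (G `<=` \bigcup_(X in C) X `|` G0)%classic /\ G z1 /\ G z2.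
    have sub X : C X -> (X `|` G0 `<=` \bigcup_(X in C) X `|` G0)%classic.
      by move=> CX z [Xz|]; [left; exists X|right].
    move=> [[X CX Xz1]|Gz1] [[Y CY Yz2]|Gz2].
    - have [XY|YX] := totC _ _ CX CY.
        exists (Y `|` G0)%classic; first exact: CP.
        by split; [exact: sub|split; left => //; exact: XY].
      exists (X `|` G0)%classic; first exact: CP.
      by split; [exact: sub|split; left => //; exact: YX].
    - exists (X `|` G0)%classic; first exact: CP.
      by split; [exact: sub|split; [left|right]].
    - exists (Y `|` G0)%classic; first exact: CP.
      by split; [exact: sub|split; [right|left]].
    - by exists G0.
  split=> [|x y a b xa yb|x a xa|x a xa|a xa].
  + by right; exact: partial_hom1.
  + have [G PG [GC [Gx Gy]]] := common _ _ xa yb.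
    by apply: GC; exact: partial_homM.
  + have [G PG [GC [Gx _]]] := common _ _ xa xa.
    by apply: GC; exact: partial_homV.
  + have [G PG [GC [Gx _]]] := common _ _ xa xa.
    exact: (partial_hom_neq0 _ PG _ _ Gx).
  + have [G PG [GC [Gx _]]] := common _ _ xa xa.
    exact: (partial_hom_fun1 _ PG).
(* By maximality, adjoining [x] cannot enlarge the graph. *)
have Atotal (x : F) : x != 0 -> exists a, (A `|` G0)%classic (x, a).
  move=> x0; have [G' [PG' sG' [c xc]]] := partial_hom_adjoin _ _ PA x0.
  have G0G' : (G0 `<=` G')%classic by move=> z Gz; apply: sG'; right.
  have [xA|xA] := pselect ((A `|` G0)%classic (x, c)); first by exists c.
  exfalso; apply: (maxA G'); last by rewrite /P (setUidl G0G').
  split; first by move=> z Az; apply: sG'; left.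
  by move=> G'A; apply: xA; left; exact: G'A.
(* The default value occurs only at [x = 0], outside the domain. *)
pose L (x : F) : V := xget 0 [set a | (A `|` G0)%classic (x, a)]%classic.
have LP (x : F) : x != 0 -> (A `|` G0)%classic (x, L x) by move=> /Atotal; exact: xgetPex.
exists L; split=> [x y x0 y0|x a xa].
  apply: (partial_hom_fun _ _ _ _ PA); first by apply: LP; rewrite mulf_neq0.
  by apply: partial_homM => //; exact: LP.
apply: (partial_hom_fun _ _ _ _ PA); last by right; exact: xa.
by apply: LP; exact: (partial_hom_neq0 _ P0 _ _ xa).
Qed.

End MultiplicativeExtension.

(** * Existence of an Iwasawa logarithm *)

Section IwasawaLogarithm.
Context {R : realType} {K : ultrametricField R} {p : nat}.
Hypothesis p_prime : prime p.
Hypothesis absvp : absv (p%:R : K) = p%:R^-1.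
Hypothesis K_complete :
  forall F : set_system K, ProperFilter F -> cauchy F -> cvg F.

Lemma plog1 : plog (1 : K) = 0.
Proof.
have lt01 : absv (1 - 1 : K) < 1 by rewrite subrr absv0.
have := plogM p_prime absvp K_complete _ _ lt01 lt01; rewrite mulr1.
by move=> /eqP; rewrite -subr_eq0 opprD addNKr oppr_eq0 => /eqP.
Qed.

Lemma plogV (u : K) : absv (u - 1) < 1 -> plog u^-1 = - plog u.
Proof.
move=> u1; have u0 : u != 0 by rewrite -absv_gt0 absv_eq1.
have := plogM p_prime absvp K_complete _ _ u1 (absv_sub1V _ u1).
by rewrite divff// plog1 => /esym/eqP; rewrite addrC addr_eq0 => /eqP.
Qed.

Lemma absv_expp_eq1 (k : int) : absv (p%:R ^ k : K) = 1 -> k = 0.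
Proof.
have expp_eq1 n : (absv (p%:R ^+ n : K) == 1) = (n == 0)%N.
  have /andP[q0 q1] := @inv_prime_itv R _ p_prime.
  by rewrite (absv_expp absvp) pexprn_eq1// (lt_eqF q1) orbF.
case: k => n; first by move=> /eqP; rewrite expp_eq1 => /eqP ->.
by rewrite NegzE -exprnN absvV => /eqP; rewrite invr_eq1 expp_eq1.
Qed.

(** The logarithm on the products of powers of [p] with the disc around 1, sending [p] to 0. It is
    single-valued because [|p^k u| = p^-k], so [p^k u = 1] forces [k = 0]. *)
Lemma partial_hom_plog :
  partial_hom [set z : K * K | exists (k : int) (u : K),
    absv (u - 1) < 1 /\ z = (p%:R ^ k * u, plog u)]%classic.
Proof.
have p0 : (p%:R : K) != 0 by rewrite (absv_natf_neq0 p_prime absvp)// prime_gt0.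
split.
- exists 0, 1; split; first by rewrite subrr absv0.
  by rewrite expr0z mulr1 plog1.
- move=> x y a b [k [u [u1 [-> ->]]]] [l [v [v1 [-> ->]]]].
  exists (k + l), (u * v); split; first exact: absv_sub1M.
  by rewrite expfzDr// mulrACA (plogM p_prime absvp K_complete).
- move=> x a [k [u [u1 [-> ->]]]].
  exists (- k), u^-1; split; first exact: absv_sub1V.
  by rewrite invfM invr_expz plogV.
- move=> x a [k [u [u1 [-> _]]]].
  by rewrite mulf_neq0 ?expfz_neq0// -absv_gt0 absv_eq1.
- move=> a [k [u [u1 [pku ->]]]]; have k0 : k = 0.
    apply: absv_expp_eq1.
    by rewrite -[absv _]mulr1 -(absv_eq1 u u1) -absvM -pku absv1 absv_eq1.
  by move: pku; rewrite k0 expr0z mul1r => <-; exact: plog1.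
Qed.

Lemma iwasawa_log_exists : exists L : K -> K, is_iwasawa_log p L.
Proof.
have [|L [LM LG]] := partial_hom_extend _ _ partial_hom_plog.
  by move=> n; exact: (absv_natf_neq0 p_prime absvp).
have LE (u : K) : absv (u - 1) < 1 -> L u = plog u.
  by move=> u1; apply: LG; exists 0, u; split => //; rewrite expr0z mul1r.
exists L; split=> //.
  by move=> x x1; rewrite LE//; exact: (plog_cvg p_prime absvp K_complete).
rewrite -plog1; apply: LG; exists 1, 1; split; first by rewrite subrr absv0.
by rewrite expr1z mulr1.
Qed.

Lemma logp_iwasawa : is_iwasawa_log p (logp p (K := K)).
Proof. exact: (getPex iwasawa_log_exists). Qed.

End IwasawaLogarithm.

(** * Convergence of Volkenborn sums *)

Section VolkenbornSums.
Context {R : realType} {K : ultrametricField R} {p : nat}.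
Hypothesis p_prime : prime p.
Hypothesis absvp : absv (p%:R : K) = p%:R^-1.
Hypothesis K_complete :
  forall F : set_system K, ProperFilter F -> cauchy F -> cvg F.

Let q : R := p%:R^-1.

Lemma sum_expnS (V : nmodType) (F : nat -> V) N :
  \sum_(0 <= j < p ^ N.+1) F j =
  \sum_(0 <= i < p) \sum_(0 <= j < p ^ N) F (j + i * p ^ N)%N.
Proof.
rewrite expnS big_nat_mul; apply: eq_bigr => i _.
by rewrite -{1}[(i * _)%N]add0n mulSn big_addn addnK.
Qed.

(** [G] acts as the derivative of [F]: [F_diff] is a Taylor expansion with quadratic remainder,
    [G_lip] a Lipschitz condition. [N > 0] keeps the increments in the disc [|h| <= 1/p], where the
    logarithm is expanded. *)
Variables (F G : nat -> K) (C : R).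
Hypothesis C_ge0 : 0 <= C.
Hypothesis F_diff : forall N j i, (0 < N)%N ->
  absv (F (j + i * p ^ N)%N - F j - (i * p ^ N)%:R * G j) <= C * q ^+ N ^+ 2.
Hypothesis G_lip : forall N j i, (0 < N)%N ->
  absv (G (j + i * p ^ N)%N - G j) <= C * q ^+ N.

Let S N := \sum_(0 <= j < p ^ N) G j.

(** Cutting into [p] blocks gives [p * S N.+1] plus increments of [G]. The first is smaller than
    [S N.+1] by the factor [q]; the others are at most [C q^(N+1) = p C q^(N+2)], whence the factor
    [p] in the bound. *)
Lemma absv_sum_expn_le N :
  absv (S N.+1) <= p%:R * (C + absv (S 1)) * q ^+ N.+1.
Proof.
have q0 : 0 <= q by rewrite invr_ge0.
have p0 : (p%:R : R) != 0 by rewrite pnatr_eq0 -lt0n prime_gt0.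
have pq : p%:R * q = 1 by rewrite divff.
have B0 n : 0 <= p%:R * (C + absv (S 1)) * q ^+ n.
  by rewrite mulr_ge0 ?exprn_ge0// mulr_ge0// addr_ge0 ?absv_ge0.
elim: N => [|N IHN]; first by rewrite expr1 mulrAC pq mul1r lerDr.
have -> : S N.+2 = p%:R * S N.+1 +
    \sum_(0 <= i < p) \sum_(0 <= j < p ^ N.+1) (G (j + i * p ^ N.+1)%N - G j).
  rewrite /S sum_expnS.
  under [X in _ = _ + X]eq_bigr do rewrite sumrB.
  by rewrite sumrB sumr_const_nat subn0 mulr_natl addrC subrK.
apply: absvD_le.
  by rewrite absvM absvp -/q [q ^+ _]exprS mulrCA ler_wpM2l.
apply: absv_sum => [|i _]; last apply: absv_sum => [|j _].
- exact: B0.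
- exact: B0.
apply: le_trans (G_lip _ _ _ _) _ => //.
rewrite [q ^+ N.+2]exprS mulrA [p%:R * _ * q]mulrAC pq mul1r.
by rewrite ler_wpM2r ?exprn_ge0// lerDl absv_ge0.
Qed.

Lemma volkenborn_sums_cvg :
  exists l : K, ((fun N => (p%:R ^+ N)^-1 * \sum_(0 <= j < p ^ N) F j) @ \oo
    --> l)%classic.
Proof.
have q01 : 0 <= q < 1 by exact: inv_prime_itv.
have q0 : 0 <= q by case/andP: q01.
have p0 : (p%:R : R) != 0 by rewrite pnatr_eq0 -lt0n prime_gt0.
have pK : (p%:R : K) != 0 by rewrite (absv_natf_neq0 p_prime absvp)// prime_gt0.
have pq : p%:R * q = 1 by rewrite divff.
apply: cvg_absv_increments => // e e0.
(* The first summand bounds the Taylor remainders divided by [p^(N+2)]; the second bounds the linear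
   term [p^-1 (sum of i) S N.+1]. *)
pose D := p%:R * C + p%:R * (p%:R * (C + absv (S 1))).
have C1 : 0 <= C + absv (S 1) by rewrite addr_ge0 ?absv_ge0.
have [M qM] := geometric_lt q D e q01 e0.
(* Starting at [M.+1] keeps the level positive, as the hypotheses on [F] and [G] require. *)
exists M.+1 => -[//|N] MN; apply: le_lt_trans (qM N.+1 (ltnW MN)).
have -> : (p%:R ^+ N.+2)^-1 * \sum_(0 <= j < p ^ N.+2) F j -
    (p%:R ^+ N.+1)^-1 * \sum_(0 <= j < p ^ N.+1) F j =
  (p%:R ^+ N.+2)^-1 * (\sum_(0 <= i < p) \sum_(0 <= j < p ^ N.+1)
     (F (j + i * p ^ N.+1)%N - F j - (i * p ^ N.+1)%:R * G j)) +
  p%:R^-1 * ((\sum_(0 <= i < p) i%:R) * S N.+1).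
  rewrite sum_expnS.
  under [X in _ = _ * X + _]eq_bigr do rewrite !sumrB -mulr_sumr natrM -mulrA.
  rewrite !sumrB sumr_const_nat subn0 -mulr_suml natrX -/(S N.+1).
  set s := \sum_(0 <= i < p) i%:R; set a := (\sum_(0 <= i < p) _).
  set b := \sum_(0 <= j < _) F j.
  rewrite -(mulr_natl b) [p%:R ^+ N.+2]exprS.
  have pN : p%:R ^+ N.+1 != 0 :> K by rewrite expf_neq0.
  by field; rewrite pK.
rewrite /D mulrDl; apply: absvD_le.
  apply: (@le_trans _ _ (p%:R * C * q ^+ N.+1)); last first.
    by rewrite lerDl !mulr_ge0// exprn_ge0.
  rewrite absvM absvV (absv_expp absvp) -/q -exprVn invrK [p%:R ^+ N.+2]exprS -!mulrA.
  rewrite ler_wpM2l//; apply: (@le_trans _ _ (p%:R ^+ N.+1 * (C * q ^+ N.+1 ^+ 2))).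
    rewrite ler_wpM2l ?exprn_ge0//; apply: absv_sum => [|i _]; last apply: absv_sum => [|j _].
    - by rewrite mulr_ge0 ?sqr_ge0.
    - by rewrite mulr_ge0 ?sqr_ge0.
    - exact: F_diff.
  by rewrite mulrCA expr2 (mulrA (p%:R ^+ N.+1)) -exprMn pq expr1n mul1r.
apply: (@le_trans _ _ (p%:R * (p%:R * (C + absv (S 1))) * q ^+ N.+1)); last first.
  by rewrite lerDr !mulr_ge0// exprn_ge0.
rewrite absvM absvV absvp invrK -mulrA ler_wpM2l//.
apply: le_trans (absv_sum_expn_le N); rewrite absvM ler_piMl ?absv_ge0//.
by apply: absv_sum => // i _; exact: absv_nat_le1.
Qed.

End VolkenbornSums.

(** * Local expansions of the logarithm and of the integrand *)

Section LocalExpansion.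
Context {R : realType} {K : ultrametricField R} {p : nat}.
Hypothesis p_prime : prime p.
Hypothesis absvp : absv (p%:R : K) = p%:R^-1.
Variable L : K -> K.
Hypothesis L_log : is_iwasawa_log p L.

Let q : R := p%:R^-1.

Lemma chi_addr (y h : K) : absv h < 1 -> chi (y + h) = chi y.
Proof.
move=> h1; rewrite /chi.
have [y1|y1] := leP 1 (absv y); first by rewrite absv_addr_lt ?y1// (lt_le_trans h1).
by rewrite leNgt absvD_lt.
Qed.

(** Write [y + h = y (1 + h / y)], where [|h / y| <= |h|] since [|y| >= 1], and apply
    [log1p_approx]. *)
Lemma iwasawa_log_addr (y h : K) : 1 <= absv y -> absv h <= q ->
  exists2 l, L (y + h) = L y + l & absv (l - h / y) <= 2 * absv (h / y) ^+ 2.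
Proof.
move=> y1 hq; have [LM Lseries _] := L_log.
have /andP[q0 q1] : 0 <= q < 1 by exact: inv_prime_itv.
have y0 : y != 0 by rewrite -absv_gt0 (lt_le_trans ltr01).
have hyq : absv (h / y) <= q.
  rewrite absvM absvV ler_pdivrMr ?absv_gt0//.
  by apply: le_trans hq _; rewrite ler_peMr.
have hy1 : absv (1 + h / y - 1) < 1 by rewrite addrAC subrr add0r (le_lt_trans hyq).
exists (L (1 + h / y)).
  rewrite -LM//; first by congr L; field.
  by rewrite -absv_gt0 absv_eq1.
by apply: (log1p_approx p_prime absvp) => //; exact: Lseries.
Qed.

Lemma iwasawa_log_chi_lip (y h : K) : absv h <= q ->
  absv (L (y + h) * chi (y + h) - L y * chi y) <= 2 * absv h.
Proof.
move=> hq; have /andP[q0 q1] : 0 <= q < 1 by exact: inv_prime_itv.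
rewrite chi_addr ?(le_lt_trans hq)// /chi; case: ifP => y1; last first.
  by rewrite !mulr0 subrr absv0 mulr_ge0 ?absv_ge0.
have [l -> lP] := iwasawa_log_addr _ _ y1 hq; rewrite !mulr1 addrAC subrr add0r.
have hy : absv (h / y) <= absv h.
  by rewrite absvM absvV ler_pdivrMr ?(lt_le_trans ltr01)// ler_peMr ?absv_ge0.
have h1 : absv h <= 1 by rewrite (le_trans hq)// ltW.
rewrite -(subrK (h / y) l) absvD_le//.
  apply: le_trans lP _; rewrite ler_wpM2l// expr2.
  apply: le_trans (hy); rewrite ler_piMl ?absv_ge0//.
  exact: le_trans hy h1.
by apply: le_trans hy _; rewrite ler_peMl ?absv_ge0// ler1n.
Qed.

(** The derivative of [y (log y - 1)] is [log y]. Where [chi y = 1], the exact remainder is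
    [(y + h) (l - h / y) + h^2 / y], and [|y + h| = |y| >= 1] bounds both parts by [2 |h|^2]. *)
Lemma gamma_integrand_diff (y h : K) : absv h <= q ->
  absv ((y + h) * (L (y + h) - 1) * chi (y + h) - y * (L y - 1) * chi y
        - h * (L y * chi y)) <= 2 * absv h ^+ 2.
Proof.
move=> hq; have /andP[q0 q1] : 0 <= q < 1 by exact: inv_prime_itv.
rewrite chi_addr ?(le_lt_trans hq)// /chi; case: ifP => y1; last first.
  by rewrite !mulr0 !subr0 absv0 mulr_ge0 ?sqr_ge0.
have [l -> lP] := iwasawa_log_addr _ _ y1 hq; rewrite !mulr1.
have y0 : 0 < absv y by rewrite (lt_le_trans ltr01).
have yK : y != 0 by rewrite -absv_gt0.
have h_lt1 : absv h < 1 by rewrite (le_lt_trans hq).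
have -> : (y + h) * (L y + l - 1) - y * (L y - 1) - h * L y =
  (y + h) * (l - h / y) + h ^+ 2 / y by field.
have h2y : absv h ^+ 2 / absv y <= absv h ^+ 2.
  by rewrite ler_pdivrMr// ler_peMr ?sqr_ge0.
apply: absvD_le; last first.
  rewrite absvM absvX absvV; apply: le_trans h2y _.
  by rewrite ler_peMl ?sqr_ge0// ler1n.
rewrite absvM absv_addr_lt ?(lt_le_trans h_lt1)//.
apply: le_trans (ler_wpM2l (ltW y0) lP) _.
rewrite absvM absvV mulrCA ler_wpM2l// exprMn mulrC.
apply: le_trans h2y; rewrite -mulrA ler_wpM2l ?sqr_ge0// expr2 -mulrA mulVf ?gt_eqF//.
by rewrite mulr1.
Qed.

End LocalExpansion.

(** * The difference equation *)

Theorem proposition3p2 (R : realType) (p : nat) (p_prime : prime p)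
    (K : ultrametricField R) (K_Cp : is_complex_padic p K) (x : K) :
  LogGammap p (x + 1) - LogGammap p x = chi x * logp p x.
Proof.
have [absvp K_complete _ _] := K_Cp.
have q01 : 0 <= (p%:R^-1 : R) < 1 by exact: inv_prime_itv.
have /andP[q0 q1] := q01.
have L_log := logp_iwasawa p_prime absvp K_complete.
set L := logp p (K := K) in L_log *.
pose f (y : K) := y * (L y - 1) * chi y; pose g (y : K) := L y * chi y.
pose q : R := p%:R^-1.
have small N i : (0 < N)%N -> absv ((i * p ^ N)%:R : K) <= q ^+ N.
  move=> N0; rewrite natrM absvM (absv_natX absvp) ler_piMl ?exprn_ge0//.
  exact: absv_nat_le1.
have qN N : (0 < N)%N -> q ^+ N <= q.
  by move=> N0; rewrite -[leRHS]expr1 ler_wiXn2l// ltW.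
have cvgf (z : K) : exists l : K,
    ((fun N => (p%:R ^+ N)^-1 * \sum_(0 <= j < p ^ N) f (z + j%:R)) @ \oo --> l)%classic.
  apply: (volkenborn_sums_cvg p_prime absvp K_complete _ (fun j => g (z + j%:R)) 2)
    => // N j i N0; rewrite natrD addrA.
    have ip := small N i N0.
    apply: le_trans (gamma_integrand_diff p_prime absvp _ L_log _ _ (le_trans ip (qN N N0))) _.
    by rewrite ler_wpM2l// lerXn2r ?nnegrE ?absv_ge0 ?exprn_ge0.
  have ip := small N i N0.
  apply: le_trans (iwasawa_log_chi_lip p_prime absvp _ L_log _ _ (le_trans ip (qN N N0))) _.
  by rewrite ler_wpM2l.
have [l lP] := cvgf x; have [l1 l1P] := cvgf (x + 1).
have -> : LogGammap p x = l by exact: (cvg_lim (@metric_hausdorff _ K) lP).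
have -> : LogGammap p (x + 1) = l1 by exact: (cvg_lim (@metric_hausdorff _ K) l1P).
apply/eqP; rewrite -subr_eq0 -absv_eq0 [chi x * _]mulrC -/(g x).
(* If the defect were nonzero, its absolute value [e] could serve as tolerance, and the estimates at
   a large [N] would give [e < e]. *)
apply/eqP/le_anti; rewrite absv_ge0 andbT leNgt; apply/negP => e0.
set e := absv _ in e0.
move/cvg_absvP: lP => /(_ e e0)[N1 N1P].
move/cvg_absvP: l1P => /(_ e e0)[N2 N2P].
have [N3 N3P] := geometric_lt q 2 e q01 e0.
(* [N > 0] ensures [|p ^ N| <= q], the range of the local expansion. *)
have [N [NN0 NN1 NN2 NN3]] :
    exists N, [/\ (0 < N)%N, (N1 <= N)%N, (N2 <= N)%N & (N3 <= N)%N].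
  exists (1 + N1 + N2 + N3)%N; split; last exact: leq_addl.
  - by rewrite -!addnA.
  - by rewrite -!addnA addnCA leq_addr.
  - by rewrite addnAC leq_addl.
have {}N1P := N1P N NN1; have {}N2P := N2P N NN2; have {}N3P := N3P N NN3.
suff : absv (l1 - l - g x) < e by rewrite ltxx.
set a1 := (X in absv (X - l1)) in N2P; set a := (X in absv (X - l)) in N1P.
(* The shift by 1 makes the sum telescope into a difference quotient of [f] at [x] with step
   [p ^ N]. *)
have a1a : a1 - a = (p%:R ^+ N)^-1 * (f (x + p%:R ^+ N) - f x).
  rewrite /a1 /a -mulrBr -sumrB; congr (_ * _).
  rewrite (eq_bigr (fun j => f (x + j.+1%:R) - f (x + j%:R))) => [|j _].
    by rewrite (telescope_sumr (fun j => f (x + j%:R)))// addr0 natrX.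
  by rewrite -addrA nat1r.
rewrite (_ : l1 - l - g x = (a - l) + (a1 - a - g x) - (a1 - l1)); last by ring.
rewrite absvD_lt ?absvN// absvD_lt//; apply: le_lt_trans N3P.
have pN : (p%:R ^+ N : K) != 0.
  by rewrite expf_neq0// (absv_natf_neq0 p_prime absvp)// prime_gt0.
rewrite a1a (_ : _ - g x =
  (p%:R ^+ N)^-1 * (f (x + p%:R ^+ N) - f x - p%:R ^+ N * g x)); last first.
  by rewrite [RHS]mulrBr mulKf.
rewrite absvM absvV (absv_expp absvp) -/q.
have qN0 : 0 < q ^+ N by rewrite exprn_gt0// invr_gt0 ltr0n prime_gt0.
(* The remainder [2 |p^N|^2] divided by [|p^N|] is the [2 q^N] made smaller than [e]. *)
rewrite ler_pdivrMl// (_ : _ * (2 * _) = 2 * absv (p%:R ^+ N : K) ^+ 2); last first.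
  by rewrite (absv_expp absvp) -/q; ring.
apply: (gamma_integrand_diff p_prime absvp _ L_log).
by rewrite (absv_expp absvp) qN.
Qed.
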